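(* Let $p\in(0,1)$ be a fixed constant and $\sigma^2=p(1-p)$. For an even integer $n$, let $M$ be the $n\times n$ matrix with $m_{ij}=p$ if $1\le |i-j|\le n/2-1$ and $m_{ij}=0$ otherwise, and let $\widehat{M}$ be a random symmetric $n\times n$ matrix with zero diagonal whose entries $\widehat m_{ij}$, $i<j$, are independent Bernoulli random variables with $\mathbb{P}(\widehat m_{ij}=1)=m_{ij}$. Let $x$ be a unit eigenvector of $M$ for $\lambda_2(M)$ and $\widehat{x}$ a unit eigenvector of $\widehat{M}$ for $\lambda_2(\widehat{M})$, with signs chosen so that $\langle x,\widehat x\rangle\ge 0$. Then there is a constant $C_0>0$ (independent of $n$) such that \[ \|x-\widehat{x}\|\le C_0 n^{-1/2} \] with probability at least $1-n^{-3}$.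
   Context: For a real symmetric matrix $X$, its eigenvalues are labelled $\lambda_1(X),\dots,\lambda_n(X)$ so that $|\lambda_1(X)|\ge|\lambda_2(X)|\ge\dots\ge|\lambda_n(X)|$; $\lambda_2(X)$ is the eigenvalue of second largest absolute value. $\|\cdot\|$ is the Euclidean norm. The matrix $M$ is the edge-probability (''model'') matrix of the random linear graph and $\widehat M$ is the adjacency matrix of the random graph. *)

(* Defs.v *)
From HB Require Import structures.
From mathcomp Require Import all_boot all_order all_algebra.
From mathcomp Require Import boolp reals.
Set Implicit Arguments. Unset Strict Implicit. Unset Printing Implicit Defensive.
Import Order.TTheory GRing.Theory Num.Theory.
Local Open Scope ring_scope.

Section Defs.
Variable R : realType.

Definition enorm n (v : 'cV[R]_n) : R := Num.sqrt (\sum_i v i 0 ^+ 2).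

Definition inner n (u v : 'cV[R]_n) : R := \sum_i u i 0 * v i 0.

(* l is lambda_2(X): the eigenvalues of X (roots of its characteristic
   polynomial, with multiplicity) can be listed as s_0, s_1, ..., s_{n-1}
   with |s_0| >= |s_1| >= ... and l = s_1 (= lambda_2 in 1-based labels). *)
Definition is_lambda2 n (X : 'M[R]_n) (l : R) : Prop :=
  exists s : seq R,
    char_poly X = \prod_(r <- s) ('X - r%:P) /\
    sorted (fun a b => `|b| <= `|a|) s /\ l = s`_1.

Definition unit_eigvec n (X : 'M[R]_n) (l : R) (x : 'cV[R]_n) : Prop :=
  X *m x = l *: x /\ enorm x = 1.

Definition model_mx n (p : R) : 'M[R]_n :=
  \matrix_(i, j) (if (i != j) && (maxn i j - minn i j <= n./2 - 1)%N then p else 0).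

(* Sample space: omega : {ffun 'I_n * 'I_n -> bool}; only coordinates (i,j)
   with i < j are used (the others are a.s. false). *)
Definition outcome n := {ffun 'I_n * 'I_n -> bool}.

Definition adj_mx n (w : outcome n) : 'M[R]_n :=
  \matrix_(i, j) (if (i < j)%N then (if w (i, j) then 1 else 0)
                  else if (j < i)%N then (if w (j, i) then 1 else 0) else 0).

Definition weight n (p : R) (w : outcome n) : R :=
  \prod_(ij : 'I_n * 'I_n)
    (if (ij.1 < ij.2)%N then
       (if w ij then model_mx n p ij.1 ij.2 else 1 - model_mx n p ij.1 ij.2)
     else (if w ij then 0 else 1)).

Definition prob n (p : R) (E : outcome n -> Prop) : R :=
  \sum_(w : outcome n | `[< E w >]) weight p w.

End Defs.

(* Main.v *)
(** Let [M] be the model matrix, [A] the adjacency matrix and [E = A - M].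

    Spectral gaps of [M].  With [n = 2m], [M] is a discretisation of [n p] times the
    integral operator on [[0, 1]] with kernel [1_{|x - y| <= 1/2}].  Test vectors
    approximating its two leading eigenfunctions give lower bounds on
    [lambda_1 ^ 2] and [lambda_2 ^ 2]; subtracting them from [tr (M ^ 2)] bounds
    [lambda_2 ^ 2] and [lambda_3 ^ 2] from above.  The bounds are sharp enough to
    yield gaps [|lambda_1| - |lambda_2|] and [|lambda_2| - |lambda_3|] of order [n p].

    Random part.  A union bound over pairs of short integer vectors [k], [l], with
    a sub-Gaussian estimate for [k^T E l], gives [||E|| = O(sqrt n)] outside an
    event of exponentially small probability.

    Perturbation.  By Weyl's inequality [|lambda_2(A)|] is within [||E||] of
    [|lambda_2(M)|], hence far from the other [|lambda_i(M)|]; the Davis-Kahan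
    argument then bounds the sine of the angle between the two eigenvectors by
    [O(||E|| / n) = O(n ^ (-1/2))]. *)

Require Import Defs.
From HB Require Import structures.
From mathcomp Require Import all_boot all_order all_algebra.
From mathcomp Require Import boolp reals.
From mathcomp Require Import sequences exp.
From mathcomp Require Import ring lra zify.
Set Implicit Arguments. Unset Strict Implicit. Unset Printing Implicit Defensive.
Import Order.TTheory GRing.Theory Num.Theory.
Local Open Scope ring_scope.

(** * Euclidean norm and symmetric matrices *)

Section Euclidean.
Variable R : realType.
Implicit Types (n : nat).

Lemma innerC n (u v : 'cV[R]_n) : inner u v = inner v u.
Proof. by apply: eq_bigr => i _; rewrite mulrC. Qed.

Lemma innerDl n (u v w : 'cV[R]_n) : inner (u + v) w = inner u w + inner v w.
Proof. by rewrite -big_split; apply: eq_bigr => i _; rewrite mxE mulrDl. Qed.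

Lemma innerZl n a (u v : 'cV[R]_n) : inner (a *: u) v = a * inner u v.
Proof. by rewrite mulr_sumr; apply: eq_bigr => i _; rewrite mxE mulrA. Qed.

Lemma innerDr n (u v w : 'cV[R]_n) : inner w (u + v) = inner w u + inner w v.
Proof. by rewrite innerC innerDl !(innerC w). Qed.

Lemma innerZr n a (u v : 'cV[R]_n) : inner v (a *: u) = a * inner v u.
Proof. by rewrite innerC innerZl innerC. Qed.

Lemma innerNr n (u v : 'cV[R]_n) : inner v (- u) = - inner v u.
Proof. by rewrite -scaleN1r innerZr mulN1r. Qed.

Lemma innerNl n (u v : 'cV[R]_n) : inner (- u) v = - inner u v.
Proof. by rewrite innerC innerNr innerC. Qed.

Lemma inner0r n (v : 'cV[R]_n) : inner v 0 = 0.
Proof. by rewrite -(scale0r 0) innerZr mul0r. Qed.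

Lemma innerE n (u v : 'cV[R]_n) : inner u v = (u^T *m v) 0 0.
Proof. by rewrite mxE; apply: eq_bigr => i _; rewrite mxE. Qed.

Lemma inner_mulmxl m n (A : 'M[R]_(m, n)) u v :
  inner (A *m u) v = inner u (A^T *m v).
Proof. by rewrite !innerE trmx_mul mulmxA. Qed.

Lemma inner_ge0 n (v : 'cV[R]_n) : 0 <= inner v v.
Proof. by apply: sumr_ge0 => i _; rewrite -expr2 sqr_ge0. Qed.

Lemma inner_eq0 n (v : 'cV[R]_n) : inner v v = 0 -> v = 0.
Proof.
move=> /eqP; rewrite psumr_eq0 => [/allP h|i _]; last by rewrite -expr2 sqr_ge0.
apply/matrixP => i j; rewrite (ord1 j) mxE.
by have := h i; rewrite mem_index_enum -expr2 sqrf_eq0 => /(_ isT) /eqP.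
Qed.

Lemma Cauchy_Schwarz n (u v : 'cV[R]_n) :
  inner u v ^+ 2 <= inner u u * inner v v.
Proof.
have [v0|vn0] := eqVneq (inner v v) 0.
  by rewrite (inner_eq0 v0) !inner0r expr0n mulr0.
have vp : 0 < inner v v by rewrite lt0r vn0 inner_ge0.
have := inner_ge0 (inner v v *: u - inner u v *: v).
rewrite !(innerDl, innerDr, innerNl, innerNr, innerZl, innerZr) (innerC v u).
set a := inner u u; set b := inner v v in vp *; set c := inner u v.
rewrite (_ : _ + _ = b * (a * b - c ^+ 2)); last by ring.
by rewrite pmulr_rge0// subr_ge0.
Qed.

Lemma enorm_ge0 n (v : 'cV[R]_n) : 0 <= enorm v.
Proof. exact: sqrtr_ge0. Qed.

Lemma enorm_sqr n (v : 'cV[R]_n) : enorm v ^+ 2 = inner v v.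
Proof.
by rewrite /enorm -[X in Num.sqrt X]/(inner v v) sqr_sqrtr ?inner_ge0.
Qed.

Lemma enorm_eq0 n (v : 'cV[R]_n) : enorm v = 0 -> v = 0.
Proof. by move=> h; apply: inner_eq0; rewrite -enorm_sqr h expr0n. Qed.

Lemma enormN n (v : 'cV[R]_n) : enorm (- v) = enorm v.
Proof. by congr Num.sqrt; apply: eq_bigr => i _; rewrite mxE sqrrN. Qed.

Lemma enormZ n a (v : 'cV[R]_n) : enorm (a *: v) = `|a| * enorm v.
Proof.
apply/eqP; rewrite -(@eqrXn2 _ 2) ?mulr_ge0 ?enorm_ge0//.
by rewrite exprMn !enorm_sqr innerZl innerZr (real_normK (num_real _)); apply/eqP; ring.
Qed.

Lemma inner_le_enorm n (u v : 'cV[R]_n) : `|inner u v| <= enorm u * enorm v.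
Proof.
rewrite -(@ler_pXn2r _ 2) ?nnegrE ?mulr_ge0 ?enorm_ge0//.
by rewrite (real_normK (num_real _)) exprMn !enorm_sqr Cauchy_Schwarz.
Qed.

Lemma enormD_le n (u v : 'cV[R]_n) : enorm (u + v) <= enorm u + enorm v.
Proof.
rewrite -(@ler_pXn2r _ 2) ?nnegrE ?addr_ge0 ?enorm_ge0//.
rewrite sqrrD !enorm_sqr !(innerDl, innerDr) (innerC v u).
have := ler_norm (inner u v); have := inner_le_enorm u v; lra.
Qed.

End Euclidean.

(** * Spectral theorem for a prescribed list of eigenvalues *)

Section Spectral.
Variable R : realType.
Implicit Types (n : nat).

Lemma char_poly_conj n (P Q A : 'M[R]_n) :
  P *m Q = 1%:M -> char_poly (P *m A *m Q) = char_poly A.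
Proof.
move=> PQ; rewrite /char_poly /char_poly_mx.
have PQm : map_mx polyC P *m map_mx polyC Q = 1%:M by rewrite -map_mxM PQ map_mx1.
rewrite !map_mxM -[X in X - _](_ : map_mx polyC P *m 'X%:M *m map_mx polyC Q = _);
  last by rewrite scalar_mxC -mulmxA PQm mulmx1.
rewrite -mulmxBl -mulmxBr !det_mulmx mulrAC -det_mulmx PQm det1 mul1r//.
Qed.

(** Reflection in the hyperplane orthogonal to [v - e], with [e] the first basis vector, exchanges
    the unit vectors [v] and [e]. This is the deflation step of the spectral theorem. When [v = e]
    there is no such hyperplane and the identity serves. *)
Lemma householder n (v : 'cV[R]_(1 + n)) : inner v v = 1 ->
  exists H : 'M[R]_(1 + n),
    [/\ H^T = H, H *m H = 1%:M & H *m v = delta_mx 0 0].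
Proof.
move=> v1; pose e : 'cV[R]_(1 + n) := delta_mx 0 0.
have ee : inner e e = 1.
  rewrite /inner (bigD1 0)//= big1 => [|i /negPf i0].
    by rewrite !mxE !eqxx addr0 mulr1.
  by rewrite !mxE i0 mul0r.
have [w0|wn0] := eqVneq (v - e) 0.
  exists 1%:M; rewrite trmx1 mulmx1 mul1mx; split=> //.
  by apply/eqP; rewrite -subr_eq0; apply/eqP.
set w := v - e in wn0 *.
have ww0 : inner w w != 0 by apply: contra_neq wn0; apply: inner_eq0.
(* By this identity the reflected vector v - (2 w.v / w.w) w is v - w = e. *)
have wv : inner w w = 2 * inner w v.
  rewrite !(innerDl, innerDr, innerNl, innerNr) v1 ee (innerC v e); ring.
have wTm m (x : 'M[R]_(_, m)) : w *m w^T *m (w *m x) = inner w w *: (w *m x).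
  rewrite -mulmxA [w^T *m _]mulmxA [w^T *m w]mx11_scalar -innerE.
  by rewrite mul_scalar_mx scalemxAr.
pose c := 2 / inner w w.
exists (1%:M - c *: (w *m w^T)); split.
- by rewrite linearB linearZ /= trmx_mul trmxK trmx1.
- rewrite mulmxBl mul1mx mulmxBr mulmx1 -scalemxAr -!scalemxAl wTm !scalerA.
  rewrite opprB addrA addrAC -!addrA -[RHS]addr0; congr (_ + _).
  rewrite -!scaleNr -!scalerDl (_ : _ + _ = 0) ?scale0r// /c; field.
  by [].
- rewrite mulmxBl mul1mx -scalemxAl -mulmxA [w^T *m v]mx11_scalar -innerE.
  rewrite mul_mx_scalar scalerA (_ : c * _ = 1) ?scale1r ?opprB 1?addrC ?subrK//.
  by rewrite /c wv; field; move: ww0; rewrite wv mulf_eq0 negb_or => /andP[].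
Qed.

(** Deflation, by induction on the dimension. The diagonal follows the order of the given list [s],
    so a list sorted by absolute value keeps its labelling. *)
Lemma spectral_sym n (X : 'M[R]_n) (s : seq R) :
  X^T = X -> char_poly X = \prod_(r <- s) ('X - r%:P) ->
  exists2 Q : 'M[R]_n, Q^T *m Q = 1%:M
    & X = Q *m diag_mx (\row_i s`_i) *m Q^T.
Proof.
elim: n X s => [|n IHn]; last rewrite -[n.+1]/(1 + n)%N; move=> X s sX cX.
  by exists 1%:M; rewrite ?trmx1 ?mulmx1// [LHS]flatmx0 [RHS]flatmx0.
case: s cX => [|a s] cX.
  by move: (size_char_poly X); rewrite cX big_nil size_poly1.
have : eigenvalue X a.
  by rewrite eigenvalue_root_char cX root_prod_XsubC mem_head.
case/eigenvalueP => v0 v0X v0n0.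
pose v := (enorm v0^T)^-1 *: v0^T.
have v0n : enorm v0^T != 0.
  by apply: contra_neq v0n0 => /enorm_eq0 h; rewrite -[v0]trmxK h trmx0.
have v1 : inner v v = 1.
  by rewrite innerZl innerZr -enorm_sqr; field.
have Xv : X *m v = a *: v.
  rewrite -scalemxAr -[X]sX -trmx_mul v0X [(a *: v0)^T]linearZ /=.
  by rewrite !scalerA mulrC.
have [H [sH HH Hv]] := @householder n v v1.
pose e : 'cV[R]_(1 + n) := delta_mx 0 0.
have vE : H *m e = v by rewrite -[e]Hv mulmxA HH mul1mx.
pose X1 : 'M[R]_(1 + n) := H *m X *m H.
have X1e : X1 *m e = a *: e.
  by rewrite /X1 -!mulmxA vE Xv -scalemxAr Hv.
have sX1 : X1^T = X1 by rewrite !trmx_mul sX sH mulmxA.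
have eE : e = col_mx 1%:M 0.
  apply/matrixP => i j; rewrite (ord1 j) !mxE /=.
  case: splitP => k; first by rewrite (ord1 k) => h; rewrite !mxE /= -val_eqE /= h.
  by move=> h; rewrite !mxE -val_eqE /= h.
(* The eigenvector [e] determines the first column of [X1], and symmetry then clears the first
   row. *)
have X1b : X1 = block_mx a%:M 0 0 (drsubmx X1).
  rewrite -[LHS]submxK; move: X1e; rewrite -{1}[X1]submxK eE mul_block_col.
  rewrite !mulmx1 !mulmx0 !addr0 scale_col_mx scaler0 scalemx1.
  move=> /eq_col_mx[-> dl0]; rewrite dl0; congr block_mx.
  by rewrite -[LHS]trmxK -[X in _ = X]trmx0 -dl0 trmx_ursub sX1.
have sX2 : (drsubmx X1)^T = drsubmx X1 by rewrite trmx_drsub sX1.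
have cX2 : char_poly (drsubmx X1) = \prod_(r <- s) ('X - r%:P).
  have : char_poly X1 = char_poly X by exact: char_poly_conj.
  rewrite cX big_cons {1}X1b {1}/char_poly char_block_diag_mx det_ublock.
  rewrite [X in X * _]det_mx11 !mxE /= !mulr1n.
  by apply: mulfI; rewrite polyXsubC_eq0.
have [Q QQ QE] := IHn _ _ sX2 cX2.
pose B : 'M[R]_(1 + n) := block_mx 1%:M 0 0 Q.
have BT : B^T = block_mx 1%:M 0 0 Q^T by rewrite tr_block_mx !trmx0 trmx1.
exists (H *m B).
  rewrite trmx_mul sH mulmxA -(mulmxA _ H H) HH mulmx1 BT /B mulmx_block.
  by rewrite !(mulmx0, mul0mx, mulmx1, addr0, add0r) QQ -scalar_mx_block.
have -> : X = H *m X1 *m H by rewrite /X1 !mulmxA HH mul1mx -mulmxA HH mulmx1.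
rewrite trmx_mul sH !mulmxA; congr (_ *m _); rewrite -!mulmxA; congr (_ *m _).
have -> : diag_mx (\row_i (a :: s)`_i) =
    block_mx a%:M 0 0 (diag_mx (\row_i s`_i)) :> 'M[R]_(1 + n).
  rewrite -[RHS](_ : diag_mx (row_mx a%:M (\row_i s`_i)) = _).
    congr diag_mx; apply/rowP => i; rewrite !mxE; case: splitP => k /= ->.
      by rewrite (ord1 k) /= mxE eqxx mulr1n.
    by rewrite mxE.
  by rewrite diag_mx_row; congr block_mx; apply/matrixP => i j;
     rewrite (ord1 i) (ord1 j) !mxE.
rewrite [LHS]mulmxA -/X1 X1b BT /B !mulmx_block.
by rewrite !(mulmx0, mul0mx, mulmx1, mul1mx, addr0, add0r) QE !mulmxA.
Qed.

End Spectral.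

(** * Coordinates in an orthonormal eigenbasis *)

Section EigenCoordinates.
Variables (R : realType) (n : nat).
Variables (X Q : 'M[R]_n) (s : seq R).
Hypothesis QQ : Q^T *m Q = 1%:M.
Hypothesis XE : X = Q *m diag_mx (\row_i s`_i) *m Q^T.

Lemma inner_coord (u v : 'cV[R]_n) : inner (Q^T *m u) (Q^T *m v) = inner u v.
Proof. by rewrite inner_mulmxl trmxK mulmxA (mulmx1C QQ) mul1mx. Qed.

Lemma coord_mulmx (v : 'cV[R]_n) i :
  (Q^T *m (X *m v)) i 0 = s`_i * (Q^T *m v) i 0.
Proof. by rewrite XE !mulmxA QQ mul1mx -mulmxA mul_diag_mx 2!mxE. Qed.

Lemma inner_mulmx_coord (v : 'cV[R]_n) :
  inner (X *m v) (X *m v) = \sum_(i < n) (s`_i * (Q^T *m v) i 0) ^+ 2.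
Proof.
by rewrite -inner_coord; apply: eq_bigr => i _; rewrite !coord_mulmx expr2.
Qed.

(** Both sides are the trace of X X^T. *)
Lemma sum_sqr_eigenvalues : \sum_(i < n) s`_i ^+ 2 = \sum_i \sum_j X i j ^+ 2.
Proof.
have sX : X^T = X by rewrite XE !trmx_mul trmxK tr_diag_mx mulmxA.
transitivity (\tr (X *m X^T)); last first.
  by apply: eq_bigr => i _; rewrite mxE; apply: eq_bigr => j _; rewrite [X^T _ _]mxE.
rewrite sX XE -!mulmxA [\tr _]mxtrace_mulC -!mulmxA QQ mulmx1.
rewrite [Q^T *m (Q *m _)]mulmxA QQ mul1mx; apply: eq_bigr => i _.
by rewrite mul_diag_mx !mxE eqxx mulr1n expr2.
Qed.

End EigenCoordinates.

(** Guarantees that the i-th entry of [s], for i < n, is a genuine eigenvalue and not the default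
    0. *)
Lemma size_eigenvalues (R : realType) n (X : 'M[R]_n) (s : seq R) :
  char_poly X = \prod_(r <- s) ('X - r%:P) -> size s = n.
Proof.
by move=> cX; move: (size_char_poly X); rewrite cX size_prod_XsubC => -[].
Qed.

Lemma sorted_abs_nth (R : realType) (s : seq R) i j :
  sorted (fun a b => `|b| <= `|a|) s -> (i <= j < size s)%N ->
  `|s`_j| <= `|s`_i|.
Proof.
move=> ss /andP[ij js].
apply: (sorted_leq_nth _ _ _ ss) => //=.
- by move=> y x z h1 h2; apply: le_trans h2 h1.
- by rewrite inE (leq_ltn_trans ij).
Qed.

(** * Variational lower bounds for the two leading eigenvalues *)

Section MinMax.
Variables (R : realType) (n : nat).
Variables (X : 'M[R]_n.+2) (s : seq R).
Hypothesis sX : X^T = X.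
Hypothesis cX : char_poly X = \prod_(r <- s) ('X - r%:P).
Hypothesis ss : sorted (fun a b => `|b| <= `|a|) s.

Let s_le (i j : nat) : (i <= j)%N -> (j < n.+2)%N -> s`_j ^+ 2 <= s`_i ^+ 2.
Proof.
move=> ij jn; rewrite -(real_normK (num_real s`_j)) -(real_normK (num_real s`_i)).
rewrite ler_pXn2r ?nnegrE//; apply: sorted_abs_nth => //.
by rewrite ij (size_eigenvalues cX).
Qed.

(** In eigencoordinates |X u|^2 is the sum of s_i^2 c_i^2, and every s_i^2 is at most s_0^2. Using
    |X u|^2 instead of u^T X u makes the signs of the eigenvalues irrelevant. *)
Lemma first_eigenvalue_ge r (u : 'cV[R]_n.+2) :
  0 < inner u u -> r * inner u u <= inner (X *m u) (X *m u) -> r <= s`_0 ^+ 2.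
Proof.
move=> u0 ru; rewrite -(ler_pM2r u0); apply: le_trans ru _.
have [Q QQ XE] := spectral_sym sX cX.
rewrite (inner_mulmx_coord QQ XE) -(inner_coord QQ) mulr_sumr.
apply: ler_sum => i _; rewrite exprMn -expr2 ler_wpM2r ?sqr_ge0//.
by apply: s_le.
Qed.

(** Courant-Fischer for X^2: the plane of [u1] and [u2] contains a nonzero vector orthogonal to the
    first eigenvector, and there |X v|^2 <= s_1^2 |v|^2. *)
Lemma second_eigenvalue_ge r (u1 u2 : 'cV[R]_n.+2) :
  0 < inner u1 u1 -> 0 < inner u2 u2 -> inner u1 u2 = 0 ->
  (forall a b, let v := a *: u1 + b *: u2 in
     r * inner v v <= inner (X *m v) (X *m v)) ->
  r <= s`_1 ^+ 2.
Proof.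
move=> u1p u2p u12 rv; have [Q QQ XE] := spectral_sym sX cX.
pose c1 := (Q^T *m u1) 0 0; pose c2 := (Q^T *m u2) 0 0.
(* The pair (c2, -c1) cancels the first eigencoordinate; it could vanish when c2 = 0, where (0, 1)
   works. *)
have [a [b [ab0 abc]]] : exists a b : R, 0 < a ^+ 2 + b ^+ 2 /\ a * c1 + b * c2 = 0.
  have [c0|c0] := eqVneq c2 0.
    by exists 0, 1; rewrite c0; split; [rewrite expr0n add0r expr1n|ring].
  exists c2, (- c1); split; last by ring.
  by rewrite ltr_wpDr ?sqr_ge0// exprn_even_gt0.
set v := a *: u1 + b *: u2; have := rv a b; rewrite /= -/v => {}rv.
have vp : 0 < inner v v.
  rewrite !(innerDl, innerDr, innerZl, innerZr) (innerC u2) u12.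
  rewrite !mulr0 !(addr0, add0r) !mulrA -!expr2.
  have [a0|a0] := eqVneq a 0.
    move: ab0; rewrite a0 expr0n !add0r => ab0.
    by rewrite mul0r add0r mulr_gt0.
  apply: ltr_wpDr; first by rewrite mulr_ge0 ?sqr_ge0 ?inner_ge0.
  by rewrite mulr_gt0 ?exprn_even_gt0.
have v0 : (Q^T *m v) 0 0 = 0.
  by rewrite mulmxDr -!scalemxAr mxE [X in X + _]mxE [X in _ + X]mxE -abc.
rewrite -(ler_pM2r vp); apply: le_trans rv _.
rewrite (inner_mulmx_coord QQ XE) -(inner_coord QQ) mulr_sumr.
apply: ler_sum => i _; have [->|i0] := eqVneq i 0.
  by rewrite v0 !mulr0 expr0n.
rewrite exprMn -expr2 ler_wpM2r ?sqr_ge0//.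
by apply: s_le => //; rewrite lt0n.
Qed.

End MinMax.

(** * Perturbation of the second eigenvalue and its eigenvector *)

(* Weyl's inequality for the second singular value. *)
Lemma second_abs_eigenvalue_le (R : realType) n (X Y : 'M[R]_n.+2) s t e :
  X^T = X -> Y^T = Y ->
  char_poly X = \prod_(r <- s) ('X - r%:P) ->
  char_poly Y = \prod_(r <- t) ('X - r%:P) ->
  sorted (fun a b => `|b| <= `|a|) s -> sorted (fun a b => `|b| <= `|a|) t ->
  (forall v, enorm ((Y - X) *m v) <= e * enorm v) ->
  `|t`_1| <= `|s`_1| + e.
Proof.
move=> sX sY cX cY ss st Ee.
(* If |t_1| <= e the claim is immediate; otherwise |t_1| - e is positive and the inequality can be
   squared. *)
have [te|te] := leP `|t`_1| e; first by have := normr_ge0 s`_1; lra.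
have [P PP YE] := spectral_sym sY cY.
rewrite -lerBlDr -(@ler_pXn2r _ 2) ?nnegrE ?subr_ge0 ?(ltW te)//.
rewrite (real_normK (num_real s`_1)).
pose d (i : 'I_n.+2) : 'cV[R]_n.+2 := delta_mx i 0.
have Pd i : P^T *m (P *m d i) = d i by rewrite mulmxA PP mul1mx.
have dd (i j : 'I_n.+2) : inner (P *m d i) (P *m d j) = (i == j)%:R.
  rewrite -(inner_coord PP) !Pd /inner (bigD1 i)//= big1 => [|k /negPf ki].
    by rewrite !mxE !eqxx mul1r addr0 andbT.
  by rewrite !mxE ki mul0r.
(* The test plane for X is spanned by the two leading eigenvectors of Y, on which |Y v| >= |t_1|
   |v|. *)
pose i0 : 'I_n.+2 := 0; pose i1 : 'I_n.+2 := 1.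
apply: (@second_eigenvalue_ge _ _ X s sX cX ss _ (P *m d i0) (P *m d i1)).
- by rewrite dd eqxx ltr01.
- by rewrite dd eqxx ltr01.
- by rewrite dd.
move=> a b /=; set v := a *: _ + b *: _.
have Yv : `|t`_1| * enorm v <= enorm (Y *m v).
  rewrite -(@ler_pXn2r _ 2) ?nnegrE ?mulr_ge0 ?enorm_ge0// exprMn !enorm_sqr.
  rewrite (real_normK (num_real t`_1)) (inner_mulmx_coord PP YE).
  rewrite -(inner_coord PP) mulr_sumr.
  apply: ler_sum => i _; rewrite exprMn -expr2.
  rewrite /v mulmxDr -!scalemxAr !Pd.
  have [ile|igt] := leqP i 1.
    rewrite ler_wpM2r ?sqr_ge0//.
    rewrite -(real_normK (num_real t`_1)) -(real_normK (num_real t`_i)).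
    rewrite ler_pXn2r ?nnegrE//; apply: sorted_abs_nth => //.
    by rewrite ile (size_eigenvalues cY).
  rewrite !mxE -!val_eqE /= (gtn_eqF igt) (gtn_eqF (ltnW igt)) /=.
  by rewrite !mulr0 addr0 expr0n !mulr0.
have Yle : enorm (Y *m v) <= enorm (X *m v) + e * enorm v.
  have -> : Y *m v = X *m v + (Y - X) *m v by rewrite mulmxBl addrC subrK.
  by apply: le_trans (enormD_le _ _) _; rewrite lerD2l.
rewrite -!enorm_sqr -exprMn ler_pXn2r ?nnegrE ?mulr_ge0 ?enorm_ge0 ?subr_ge0 ?(ltW te)//.
by rewrite mulrBl lerBlDr (le_trans Yv).
Qed.

(* The Davis-Kahan argument: [(X - t1) y = (X - Y) y], and by Weyl's inequality
   [t1] is far from every eigenvalue of [X] except the second one. *)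
Lemma second_eigvec_perturbation (R : realType) n (X Y : 'M[R]_n.+2) s t e g x y :
  X^T = X -> Y^T = Y ->
  char_poly X = \prod_(r <- s) ('X - r%:P) ->
  char_poly Y = \prod_(r <- t) ('X - r%:P) ->
  sorted (fun a b => `|b| <= `|a|) s -> sorted (fun a b => `|b| <= `|a|) t ->
  (forall v, enorm ((Y - X) *m v) <= e * enorm v) ->
  0 < g -> 2 * e <= g -> `|s`_1| + g <= `|s`_0| ->
  (forall i, (1 < i < n.+2)%N -> `|s`_i| + g <= `|s`_1|) ->
  unit_eigvec X s`_1 x -> unit_eigvec Y t`_1 y -> 0 <= inner x y ->
  inner (x - y) (x - y) * g ^+ 2 <= 8 * e ^+ 2.
Proof.
move=> sX sY cX cY ss st Ee g0 eg s01 s1i [Xx x1] [Yy y1] xy0.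
have Ee' v : enorm ((X - Y) *m v) <= e * enorm v.
  by rewrite -opprB mulNmx enormN.
have e0 : 0 <= e.
  by have := Ee y; rewrite y1 mulr1; apply: le_trans; rewrite enorm_ge0.
(* Weyl in both directions: |s_1| and |t_1| differ by at most e. *)
have ts := second_abs_eigenvalue_le sX sY cX cY ss st Ee.
have st' := second_abs_eigenvalue_le sY sX cY cX st ss Ee'.
have [Q QQ XE] := spectral_sym sX cX.
have far (i : 'I_n.+2) : i != 1 -> `|s`_1| + g <= `|s`_i| \/ `|s`_i| + g <= `|s`_1|.
  rewrite -val_eqE /=; case: i => -[|[|i]] hi //= _; first by left.
  by right; apply: s1i.
pose c := Q^T *m y; pose d := Q^T *m x.
(* The gap makes s_1 a simple eigenvalue, so [x] has only its coordinate of index 1. *)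
have dE (i : 'I_n.+2) : i != 1 -> d i 0 = 0.
  move=> i1; have := coord_mulmx QQ XE x i; rewrite Xx -scalemxAr mxE -/d => h.
  have : (s`_1 - s`_i) * d i 0 = 0 by rewrite mulrBl h subrr.
  move=> /eqP; rewrite mulf_eq0 => /orP[|/eqP//].
  rewrite subr_eq0 => /eqP h1.
  by case: (far _ i1); rewrite -h1 gerDl leNgt g0.
have dd : d 1 0 ^+ 2 = 1.
  have := inner_coord QQ x x; rewrite -[inner x x]enorm_sqr x1 expr1n => <-.
  rewrite /inner (bigD1 1)//= big1 ?addr0 ?expr2// => i i1.
  by rewrite -/d dE ?mul0r.
have xyE : inner x y = d 1 0 * c 1 0.
  rewrite -(inner_coord QQ) /inner (bigD1 1)//= big1 ?addr0// => i i1.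
  by rewrite -/d dE ?mul0r.
have cc : c 1 0 ^+ 2 + \sum_(i | i != 1) c i 0 ^+ 2 = 1.
  have := inner_coord QQ y y; rewrite -[inner y y]enorm_sqr y1 expr1n => <-.
  by rewrite /inner [RHS](bigD1 1).
(* The coordinates of (X - Y) y are (s_i - t_1) c_i, and for i <> 1 the gap gives |s_i - t_1| >= g -
   e >= g / 2. *)
have rest : (g / 2) ^+ 2 * (\sum_(i | i != 1) c i 0 ^+ 2) <= e ^+ 2.
  have : enorm ((X - Y) *m y) ^+ 2 <= e ^+ 2.
    rewrite ler_pXn2r ?nnegrE ?enorm_ge0//.
    by apply: le_trans (Ee' y) _; rewrite y1 mulr1.
  apply: le_trans; rewrite enorm_sqr -(inner_coord QQ) /inner [leRHS](bigD1 1)//=.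
  apply: ler_wpDl; first by rewrite -expr2 sqr_ge0.
  rewrite mulr_sumr.
  apply: ler_sum => i i1; rewrite -expr2.
  have -> : (Q^T *m ((X - Y) *m y)) i 0 = (s`_i - t`_1) * c i 0.
    rewrite mulmxBl Yy mulmxBr [LHS]mxE (coord_mulmx QQ XE) -scalemxAr.
    by rewrite [X in _ + X]mxE [X in _ - X]mxE -mulrBl.
  rewrite [leRHS]exprMn.
  rewrite ler_wpM2r ?sqr_ge0// -(real_normK (num_real (_ - _))).
  rewrite ler_pXn2r ?nnegrE ?normr_ge0//; last by lra.
  case: (far _ i1) => h; last rewrite distrC.
    by apply: le_trans (lerB_dist _ _); lra.
  by apply: le_trans (lerB_dist _ _); lra.
move: cc rest; set r := \sum_(i | _) _ => cc rest.
have -> : inner (x - y) (x - y) = 2 - 2 * inner x y.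
  rewrite !(innerDl, innerDr, innerNl, innerNr) -!enorm_sqr x1 y1 (innerC y x).
  ring.
set z := inner x y in xy0 *.
have zz : z ^+ 2 = 1 - r by rewrite /z xyE exprMn dd mul1r; lra.
have r0 : 0 <= r by apply: sumr_ge0 => i _; rewrite sqr_ge0.
have z1 : z <= 1.
  by rewrite -(@ler_pXn2r _ 2) ?nnegrE// zz expr1n; lra.
(* The sign choice enters here: 0 <= z <= 1 gives 1 - z <= 1 - z^2 = r. With r g^2 / 4 <= e^2 this
   produces the constant 8. *)
have : 2 - 2 * z <= 2 * r by nra.
have := sqr_ge0 g; nra.
Qed.

(** * Spectral gaps of the model matrix *)

Section Model.
Variable R : realType.

Lemma model_mx_sym n (p : R) : (model_mx n p)^T = model_mx n p.
Proof. by apply/matrixP => i j; rewrite !mxE eq_sym maxnC minnC. Qed.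

(** The test vectors are even or odd under i -> 2m - 1 - i, so their sums reduce to i < m. *)
Lemma sum_reflect m (F : nat -> R) :
  \sum_(i < m + m) F i = \sum_(i < m) (F i + F (m + m - i.+1)%N).
Proof.
rewrite big_split_ord big_split /=; congr (_ + _).
rewrite (reindex_inj rev_ord_inj) /=; apply: eq_bigr => i _.
by congr F; have := ltn_ord i; lia.
Qed.

(** Row i equals p on the columns from max(0, i + 1 - m) up to, but excluding, min(i + m, 2m),
    except on the diagonal. With a discrete primitive [G] of [f] the sum over this window
    telescopes; [- f i] removes the diagonal, and truncated subtraction supplies the maximum with
    0. *)
Lemma model_mulmx (p : R) n m (f G : nat -> R) (i : 'I_n) :
  n = (m + m)%N -> (forall j, f j = G j.+1 - G j) ->
  (model_mx n p *m \col_j f j) i 0 =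
  p * (G (minn (i + m) (m + m)) - G (i.+1 - m)%N - f i).
Proof.
move=> nE fG; set C := fun j : nat => (i.+1 - m <= j)%N && (j < minn (i + m) (m + m))%N.
have ilt : (i < m + m)%N by rewrite -nE.
transitivity (p * (\sum_(j < n) (if C j then f j else 0)
                   - \sum_(j < n) (if j == i then f j else 0))).
  rewrite mulrBr !mulr_sumr -sumrB mxE; apply: eq_bigr => j _.
  rewrite !mxE -!val_eqE /= eq_sym /C.
  have jlt : (j < m + m)%N by rewrite -nE.
  have -> : n./2 = m by rewrite nE addnn doubleK.
  have -> : (maxn i j - minn i j <= m - 1)%N =
    (i.+1 - m <= j)%N && (j < minn (i + m) (m + m))%N by apply/idP/idP; lia.
  have [ji|ji] := eqVneq (j : nat) (i : nat).
    have -> : (i.+1 - m <= j)%N && (j < minn (i + m) (m + m))%N by lia.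
    by rewrite /= subrr mul0r.
  by rewrite /= mulr0 subr0; case: (_ && _); rewrite ?mulr0 ?mul0r.
congr (_ * (_ - _)); last by rewrite -big_mkcond big_pred1_eq.
rewrite -big_mkcond -(big_mkord C) /= [X in index_iota _ X]nE.
have lohi : (i.+1 - m <= minn (i + m) (m + m))%N by lia.
rewrite -(telescope_sumr G lohi) [RHS](eq_bigr f); last by move=> j _; rewrite fG.
rewrite [RHS](big_nat_widen _ _ (m + m))%N ?geq_minr//.
rewrite [RHS](big_nat_widenl _ 0)//.
by apply: eq_bigl => j; rewrite andbC.
Qed.

Lemma sum_sqr_shift (x : R) k :
  \sum_(i < k) (x + i%:R) ^+ 2 =
  k%:R * x ^+ 2 + x * k%:R * (k%:R - 1) + k%:R * (k%:R - 1) * (2 * k%:R - 1) / 6.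
Proof.
elim: k => [|k IH]; first by rewrite big_ord0; ring.
by rewrite big_ord_recr /= IH -natr1; field.
Qed.

Lemma sum_shift (x : R) k :
  \sum_(i < k) (x + i%:R) = k%:R * x + k%:R * (k%:R - 1) / 2.
Proof.
elim: k => [|k IH]; first by rewrite big_ord0; ring.
by rewrite big_ord_recr /= IH -natr1; field.
Qed.

Lemma sum_sqr_arith (x : R) k :
  \sum_(i < k) (x - 2 * i%:R) ^+ 2 =
  k%:R * x ^+ 2 - 2 * x * k%:R * (k%:R - 1)
  + 4 * (k%:R * (k%:R - 1) * (2 * k%:R - 1) / 6).
Proof.
elim: k => [|k IH]; first by rewrite big_ord0; ring.
by rewrite big_ord_recr /= IH -natr1; field.
Qed.

Lemma sum_sqr_quadratic (c : R) k :
  \sum_(i < k) (c + 2 * i%:R - i%:R ^+ 2) ^+ 2 =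
  k%:R * c ^+ 2 + 2 * c * (k%:R * (k%:R - 1))
  + (4 - 2 * c) * (k%:R * (k%:R - 1) * (2 * k%:R - 1) / 6)
  - (k%:R * (k%:R - 1)) ^+ 2
  + k%:R * (k%:R - 1) * (2 * k%:R - 1) * (3 * k%:R ^+ 2 - 3 * k%:R - 1) / 30.
Proof.
elim: k => [|k IH]; first by rewrite big_ord0; ring.
by rewrite big_ord_recr /= IH -natr1; field.
Qed.

(** * A constant and a linear test vector *)

Section TestVectors.
Variables (p : R) (k m : nat).
Hypothesis kE : k.+2 = (m + m)%N.
Let M := model_mx k.+2 p.
(* [u2] is linear in place of the limiting eigenfunction [cos (pi t)]: with a
   sign vector the estimates below leave no gap between [lambda_2] and [lambda_3]. *)
Let u1 : 'cV[R]_k.+2 := \col_(j < k.+2) 1.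
Let u2 : 'cV[R]_k.+2 := \col_(j < k.+2) (2 * m%:R - 1 - 2 * j%:R).

Let sum_reflect_ord (F : nat -> R) :
  \sum_(i < k.+2) F i = \sum_(i < m) (F i + F (m + m - i.+1)%N).
Proof. by rewrite kE sum_reflect. Qed.

(** The entries of M u1 and M u2 are written as functions on [nat] so that they can be evaluated at
    reflected indices. [G2] is a discrete primitive of 2m - 1 - 2j. *)
Let F1 (i : nat) : R := p * ((minn (i + m) (m + m))%:R - (i.+1 - m)%N%:R - 1).
Let G2 (i : nat) : R := i%:R * (2 * m%:R - i%:R).
Let F2 (i : nat) : R :=
  p * (G2 (minn (i + m) (m + m)) - G2 (i.+1 - m)%N - (2 * m%:R - 1 - 2 * i%:R)).

Let Mu1E (i : 'I_k.+2) : (M *m u1) i 0 = F1 i.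
Proof.
rewrite (@model_mulmx p _ m (fun=> 1) (fun j => j%:R))// => j.
by rewrite -natr1; ring.
Qed.

Let Mu2E (i : 'I_k.+2) : (M *m u2) i 0 = F2 i.
Proof.
rewrite (@model_mulmx p _ m (fun j => 2 * m%:R - 1 - 2 * j%:R) G2)// => j.
by rewrite /G2 -natr1; ring.
Qed.

(** For i < m the window of row i starts at column 0, and that of the reflected row ends at the last
    column. *)
Let F1E (i : 'I_m) :
  F1 i = p * (m%:R - 1 + i%:R) /\ F1 (m + m - i.+1)%N = p * (m%:R - 1 + i%:R).
Proof.
have im := ltn_ord i; rewrite /F1.
have -> : minn (i + m) (m + m) = (i + m)%N by lia.
have -> : (i.+1 - m = 0)%N by lia.
have -> : minn (m + m - i.+1 + m) (m + m) = (m + m)%N by lia.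
have -> : ((m + m - i.+1).+1 - m = m - i)%N by lia.
by rewrite natrB ?(ltnW im)// !natrD; split; ring.
Qed.

Let F2E (i : 'I_m) :
  F2 i = p * ((m%:R - 1) ^+ 2 + 2 * i%:R - i%:R ^+ 2) /\
  F2 (m + m - i.+1)%N = - (p * ((m%:R - 1) ^+ 2 + 2 * i%:R - i%:R ^+ 2)).
Proof.
have im := ltn_ord i; rewrite /F2 /G2.
have -> : minn (i + m) (m + m) = (i + m)%N by lia.
have -> : (i.+1 - m = 0)%N by lia.
have -> : minn (m + m - i.+1 + m) (m + m) = (m + m)%N by lia.
have -> : ((m + m - i.+1).+1 - m = m - i)%N by lia.
have -> : (m + m - i.+1)%N%:R = m%:R + m%:R - i%:R - 1 :> R.
  by rewrite natrB; [rewrite natrD -natr1; ring | lia].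
by rewrite natrB ?(ltnW im)// !natrD; split; ring.
Qed.

(** Entries are 0 or p, so their squares are p times themselves, and the sum is p times the sum of
    the entries of M u1. *)
Lemma model_frobenius :
  \sum_i \sum_j M i j ^+ 2 = 3 * m%:R * (m%:R - 1) * p ^+ 2.
Proof.
transitivity (\sum_(i < k.+2) p * F1 i).
  apply: eq_bigr => i _; rewrite -Mu1E mxE mulr_sumr; apply: eq_bigr => j _.
  by rewrite !mxE; case: ifP => _; ring.
rewrite -mulr_sumr sum_reflect_ord.
rewrite (eq_bigr (fun i : 'I_m => (2 * p) * (m%:R - 1 + i%:R))); last first.
  by move=> i _; have [-> ->] := F1E i; ring.
by rewrite -mulr_sumr sum_shift; field.
Qed.

Lemma inner_u1 : inner u1 u1 = 2 * m%:R.
Proof.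
rewrite /inner (eq_bigr (fun=> 1)); last by move=> i _; rewrite mxE mulr1.
by rewrite sumr_const card_ord kE natrD; ring.
Qed.

Lemma inner_Mu1 : inner (M *m u1) (M *m u1) =
  p ^+ 2 * (2 * m%:R) * ((m%:R - 1) * (14 * m%:R - 13) / 6).
Proof.
rewrite /inner (eq_bigr (fun i : 'I_k.+2 => F1 i * F1 i)); last first.
  by move=> i _; rewrite Mu1E.
rewrite (sum_reflect_ord (fun i => F1 i * F1 i)).
rewrite (eq_bigr (fun i : 'I_m => (2 * p ^+ 2) * (m%:R - 1 + i%:R) ^+ 2)); last first.
  by move=> i _; have [-> ->] := F1E i; ring.
by rewrite -mulr_sumr sum_sqr_shift; field.
Qed.

Lemma inner_u2 : inner u2 u2 = 2 * m%:R * (4 * m%:R ^+ 2 - 1) / 3.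
Proof.
pose f (i : nat) : R := 2 * m%:R - 1 - 2 * i%:R.
rewrite /inner (eq_bigr (fun i : 'I_k.+2 => f i * f i)); last first.
  by move=> i _; rewrite mxE.
rewrite (sum_reflect_ord (fun i => f i * f i)).
rewrite (eq_bigr (fun i : 'I_m => 2 * (2 * m%:R - 1 - 2 * i%:R) ^+ 2)); last first.
  move=> i _; rewrite /f natrB; last by have := ltn_ord i; lia.
  by rewrite natrD -natr1; ring.
by rewrite -mulr_sumr sum_sqr_arith; field.
Qed.

Lemma inner_u12 : inner u1 u2 = 0.
Proof.
pose f (i : nat) : R := 2 * m%:R - 1 - 2 * i%:R.
rewrite /inner (eq_bigr (fun i : 'I_k.+2 => f i)); last first.
  by move=> i _; rewrite !mxE mul1r.
rewrite (sum_reflect_ord f) big1// => i _.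
rewrite /f natrB; last by have := ltn_ord i; lia.
by rewrite natrD -natr1; ring.
Qed.

Lemma inner_Mu2 : inner (M *m u2) (M *m u2) =
  2 * p ^+ 2 * \sum_(i < m) ((m%:R - 1) ^+ 2 + 2 * i%:R - i%:R ^+ 2) ^+ 2.
Proof.
rewrite /inner (eq_bigr (fun i : 'I_k.+2 => F2 i * F2 i)); last first.
  by move=> i _; rewrite Mu2E.
rewrite (sum_reflect_ord (fun i => F2 i * F2 i)) mulr_sumr.
by apply: eq_bigr => i _; have [-> ->] := F2E i; ring.
Qed.

(** M u1 is even and M u2 is odd under reflection, so paired terms cancel. *)
Lemma inner_Mu12 : inner (M *m u1) (M *m u2) = 0.
Proof.
rewrite /inner (eq_bigr (fun i : 'I_k.+2 => F1 i * F2 i)); last first.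
  by move=> i _; rewrite Mu1E Mu2E.
rewrite (sum_reflect_ord (fun i => F1 i * F2 i)) big1// => i _.
by have [-> ->] := F1E i; have [-> ->] := F2E i; ring.
Qed.

(** The exact quotient is p^2 (m - 1)(14 m - 13) / 6, with leading coefficient 7/3, just above
    23/10; a large m absorbs the lower-order terms. *)
Lemma inner_Mu1_ge : (1000 <= m)%N ->
  23 / 10 * p ^+ 2 * m%:R ^+ 2 * inner u1 u1 <= inner (M *m u1) (M *m u1).
Proof.
move=> m1; rewrite inner_Mu1 inner_u1.
have mR : 1000 <= m%:R :> R by rewrite (ler_nat R 1000).
have p2 := sqr_ge0 p; set y := m%:R in mR *.
rewrite -subr_ge0 (_ : _ - _ =
  p ^+ 2 * (2 * y) * ((y - 1000) * (y / 30) + (1000 / 30 - 27 / 6) * y + 13 / 6)).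
  have h : 0 <= (y - 1000) * (y / 30) by apply: mulr_ge0; lra.
  by apply: mulr_ge0; [apply: mulr_ge0 | ]; lra.
by field.
Qed.

(** The quotient has leading coefficient (16/15) / (8/3) = 2/5, just above 39/100. *)
Lemma inner_Mu2_ge : (1000 <= m)%N ->
  39 / 100 * p ^+ 2 * m%:R ^+ 2 * inner u2 u2 <= inner (M *m u2) (M *m u2).
Proof.
move=> m1; rewrite inner_Mu2 inner_u2 sum_sqr_quadratic.
have mR : 1000 <= m%:R :> R by rewrite (ler_nat R 1000).
have p2 := sqr_ge0 p; set y := m%:R in mR *.
rewrite -subr_ge0 (_ : _ - _ = p ^+ 2 * y * ((y - 1000) * (2 / 75 * y ^+ 3)
  + 73 / 3 * y ^+ 3 + 239 / 150 * y ^+ 2 + 4 / 3 * (y - 1000) + (4000 / 3 - 7 / 5))).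
  have y0 : 0 <= y by lra.
  have y2 : 0 <= y ^+ 2 by exact: sqr_ge0.
  have y3 : 0 <= y ^+ 3 by exact: exprn_ge0.
  have h : 0 <= (y - 1000) * (2 / 75 * y ^+ 3) by apply: mulr_ge0; lra.
  by apply: mulr_ge0; [apply: mulr_ge0 | ]; lra.
by field.
Qed.

(** With q = p m: the squares sum to at most 3 q^2, while s_0^2 >= 2.3 q^2 and s_1^2 >= 0.39 q^2.
    Hence s_1^2 <= 0.7 q^2 and s_i^2 <= 0.31 q^2 for i >= 2, so both gaps between squares are at
    least 0.08 q^2. *)
Lemma model_eigenvalue_gaps s : 0 < p -> (1000 <= m)%N ->
  char_poly M = \prod_(r <- s) ('X - r%:P) ->
  sorted (fun a b => `|b| <= `|a|) s ->
  `|s`_1| + m%:R * p / 50 <= `|s`_0| /\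
  forall i, (1 < i < k.+2)%N -> `|s`_i| + m%:R * p / 50 <= `|s`_1|.
Proof.
move=> p0 m1 cM ss.
have mR : 1000 <= m%:R :> R by rewrite (ler_nat R 1000).
have sM : M^T = M by exact: model_mx_sym.
set y := m%:R in mR *; pose q := p * y.
have qE0 : q = p * y by [].
have q0 : 0 < q by rewrite mulr_gt0//; lra.
clearbody q.
have u1p : 0 < inner u1 u1 by rewrite inner_u1 -/y; lra.
have u2p : 0 < inner u2 u2.
  rewrite inner_u2 -/y; apply: mulr_gt0; last by rewrite invr_gt0.
  by apply: mulr_gt0; [lra | nra].
have s0 : 23 / 10 * q ^+ 2 <= s`_0 ^+ 2.
  apply: (first_eigenvalue_ge sM cM ss u1p).
  by apply: le_trans (inner_Mu1_ge m1); rewrite -/y qE0 exprMn !mulrA.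
(* Both u1, u2 and their images are orthogonal pairs, so the two separate estimates add up on the
   whole plane. *)
have s1 : 39 / 100 * q ^+ 2 <= s`_1 ^+ 2.
  apply: (second_eigenvalue_ge sM cM ss u1p u2p inner_u12) => a b /=.
  rewrite mulmxDr -!scalemxAr.
  rewrite !(innerDl, innerDr, innerZl, innerZr) (innerC u2 u1) inner_u12.
  rewrite (innerC (M *m u2) (M *m u1)) inner_Mu12 !mulr0 !addr0 !add0r mulrDr.
  have h1 := inner_Mu1_ge m1; have h2 := inner_Mu2_ge m1.
  have qE c : c * p ^+ 2 * m%:R ^+ 2 = c * q ^+ 2 by rewrite qE0 /y; ring.
  rewrite qE in h1; rewrite qE in h2.
  have {}h1 : 39 / 100 * q ^+ 2 * inner u1 u1 <= inner (M *m u1) (M *m u1).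
    by apply: le_trans h1; rewrite ler_pM2r//; have := sqr_ge0 q; lra.
  have sq c X1 : 39 / 100 * q ^+ 2 * (c * (c * X1)) = c ^+ 2 * (39 / 100 * q ^+ 2 * X1).
    by ring.
  have sq' c X1 : c * (c * X1) = c ^+ 2 * X1 :> R by ring.
  by rewrite !sq !sq'; apply: lerD; apply: ler_wpM2l; rewrite ?sqr_ge0.
have FE : \sum_(i < k.+2) s`_i ^+ 2 <= 3 * q ^+ 2.
  have [Q QQ ME] := spectral_sym sM cM.
  rewrite (sum_sqr_eigenvalues QQ ME) model_frobenius -/y qE0 exprMn.
  have := sqr_ge0 p; nra.
(* As |a| + |b| <= 4 q, a gap of 0.08 q^2 between squares gives 0.08 q / 4 = q / 50 between absolute
   values. *)
have gap (a b : R) : 8 / 100 * q ^+ 2 <= a ^+ 2 - b ^+ 2 -> a ^+ 2 <= 3 * q ^+ 2 ->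
    `|b| + y * p / 50 <= `|a|.
  move=> h1 h2; rewrite -(real_normK (num_real a)) in h1 h2.
  rewrite -(real_normK (num_real b)) in h1.
  have : `|a| <= 2 * q.
    rewrite -(@ler_pXn2r _ 2) ?nnegrE ?normr_ge0 ?mulr_ge0 ?(ltW q0)//.
    by rewrite exprMn; have := sqr_ge0 q; lra.
  have yq : y * p = q by rewrite qE0 mulrC.
  have := normr_ge0 a; have := normr_ge0 b.
  set A := `|a| in h1 h2 *; set B := `|b| in h1 *.
  move=> B0 A0 A2; rewrite leNgt; apply/negP => h.
  have AB : B <= A by rewrite -(@ler_pXn2r _ 2) ?nnegrE//; have := sqr_ge0 q; lra.
  have : (A - B) * (A + B) <= q / 50 * (4 * q).
    by apply: ler_pM; lra.
  nra.
move: FE; rewrite big_ord_recl big_ord_recl /= => FE.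
have rest0 : 0 <= \sum_(i < k) s`_(bump 0 (bump 0 i)) ^+ 2.
  by apply: sumr_ge0 => i _; exact: sqr_ge0.
have q2 := sqr_ge0 q.
have s1' := sqr_ge0 s`_1.
split=> [|[|[|i]]//= ik].
  by apply: gap; lra.
have : s`_i.+2 ^+ 2 <= \sum_(i < k) s`_(bump 0 (bump 0 i)) ^+ 2.
  rewrite (bigD1 (Ordinal (ik : (i < k)%N)))//=.
  by rewrite lerDl; apply: sumr_ge0 => j _; exact: sqr_ge0.
by move=> h; apply: gap; lra.
Qed.

End TestVectors.
End Model.

(** * Operator norm from integer test vectors *)

Section Net.
Variables (R : realType) (n : nat) (E : 'M[R]_n) (T : R).
Hypothesis n_gt0 : (0 < n)%N.
Hypothesis T_ge0 : 0 <= T.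
Hypothesis E_le1 : forall i j, `|E i j| <= 1.
(** [k] and [l] will be integer parts of 20 sqrt n x and 20 sqrt n y with x, y in the unit ball,
    whence the bound 400 n on the squared norms. *)
Hypothesis E_net : forall k l : 'I_n -> nat,
  (\sum_i k i ^ 2 <= 400 * n)%N -> (\sum_i l i ^ 2 <= 400 * n)%N ->
  `|\sum_i \sum_j (k i)%:R * E i j * (l j)%:R| <= T * n%:R * Num.sqrt n%:R.

Let N : R := Num.sqrt n%:R.

Let N_gt0 : 0 < N. Proof. by rewrite sqrtr_gt0 ltr0n. Qed.
Let NN : N ^+ 2 = n%:R. Proof. by rewrite sqr_sqrtr ?ler0n. Qed.

Let bounded_by S := forall x y : 'cV[R]_n,
  `|inner x (E *m y)| <= S * (enorm x * enorm y).

Lemma bounded_by_unit S :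
  (forall x y : 'cV[R]_n, enorm x <= 1 -> enorm y <= 1 ->
    `|inner x (E *m y)| <= S) -> bounded_by S.
Proof.
move=> h x y.
have [/enorm_eq0 ->|xn] := eqVneq (enorm x) 0.
  by rewrite innerC inner0r normr0 -(scale0r 0) enormZ normr0 !mul0r mulr0.
have [/enorm_eq0 ->|yn] := eqVneq (enorm y) 0.
  by rewrite mulmx0 inner0r normr0 -(scale0r 0) enormZ normr0 !(mul0r, mulr0).
have xp : 0 < enorm x by rewrite lt0r xn enorm_ge0.
have yp : 0 < enorm y by rewrite lt0r yn enorm_ge0.
have := h ((enorm x)^-1 *: x) ((enorm y)^-1 *: y).
rewrite !enormZ !normfV !(ger0_norm (enorm_ge0 _)) !mulVf// => /(_ (lexx _) (lexx _)).
rewrite innerZl -scalemxAr innerZr !normrM !normfV !(ger0_norm (enorm_ge0 _)).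
by rewrite mulrA -invfM mulrC ler_pdivrMr ?mulr_gt0.
Qed.

Lemma enorm_coord n' (x : 'cV[R]_n') i : `|x i 0| <= enorm x.
Proof.
rewrite -(@ler_pXn2r _ 2) ?nnegrE ?enorm_ge0// enorm_sqr.
rewrite (real_normK (num_real _)) /inner (bigD1 i)//= -expr2 lerDl.
by apply: sumr_ge0 => j _; rewrite -expr2 sqr_ge0.
Qed.

(** A crude finite bound from which the contraction can start. *)
Lemma bounded_by_trivial : bounded_by (n%:R ^+ 2).
Proof.
move=> x y; rewrite /inner; apply: le_trans (ler_norm_sum _ _ _) _.
have -> : n%:R ^+ 2 * (enorm x * enorm y) =
    \sum_(i < n) \sum_(j < n) enorm x * enorm y.
  by rewrite !sumr_const !card_ord -mulrnA -[RHS]mulr_natl natrM; ring.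
apply: ler_sum => i _; rewrite mxE mulr_sumr.
apply: le_trans (ler_norm_sum _ _ _) _; apply: ler_sum => j _.
rewrite !normrM; apply: ler_pM; rewrite ?mulr_ge0 ?enorm_coord//.
by rewrite -[leRHS]mul1r; apply: ler_pM; rewrite ?enorm_coord.
Qed.

Lemma enorm_le n' (x y : 'cV[R]_n') :
  (forall i, `|x i 0| <= `|y i 0|) -> enorm x <= enorm y.
Proof.
move=> h; rewrite -(@ler_pXn2r _ 2) ?nnegrE ?enorm_ge0// !enorm_sqr.
apply: ler_sum => i _; rewrite -!expr2.
rewrite -(real_normK (num_real (x i 0))) -(real_normK (num_real (y i 0))).
by rewrite ler_pXn2r ?nnegrE.
Qed.

(* Rounding [20 sqrt n x] and [20 sqrt n y] down leaves remainders of norm at most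
   [sqrt n], so the form is controlled by its values on integer vectors up to a
   contraction of the bound [S] itself. *)
Lemma bounded_nonneg S (x y : 'cV[R]_n) : 0 <= S -> bounded_by S ->
  (forall i, 0 <= x i 0) -> (forall i, 0 <= y i 0) ->
  enorm x <= 1 -> enorm y <= 1 ->
  `|inner x (E *m y)| <= (T * N + 40 * S) / 400.
Proof.
move=> S0 bS x0 y0 x1 y1.
pose trunc (z : 'cV[R]_n) i := Num.truncn (20 * N * z i 0).
pose tc (z : 'cV[R]_n) : 'cV[R]_n := \col_i (trunc z i)%:R.
have zi (z : 'cV[R]_n) i : 0 <= z i 0 -> 0 <= 20 * N * z i 0.
  by move=> z0; rewrite !mulr_ge0 ?(ltW N_gt0).
have tc_le (z : 'cV[R]_n) : (forall i, 0 <= z i 0) -> enorm z <= 1 ->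
    enorm (tc z) <= 20 * N.
  move=> z0 z1; apply: (@le_trans _ _ (enorm ((20 * N) *: z))).
    apply: enorm_le => i; rewrite !mxE !ger0_norm ?zi ?ler0n//.
    by have /andP[] := truncn_itv (zi _ _ (z0 i)).
  have N20 : 0 < 20 * N by rewrite mulr_gt0.
  by rewrite enormZ gtr0_norm// ler_piMr// ltW.
have tc_sum (z : 'cV[R]_n) : (forall i, 0 <= z i 0) -> enorm z <= 1 ->
    (\sum_i trunc z i ^ 2 <= 400 * n)%N.
  move=> z0 z1; rewrite -(ler_nat R) natr_sum natrM -NN.
  have -> : 400 * N ^+ 2 = (20 * N) ^+ 2 by ring.
  apply: (@le_trans _ _ (enorm (tc z) ^+ 2)); last first.
    by rewrite ler_pXn2r ?nnegrE ?enorm_ge0 ?tc_le// mulr_ge0 ?(ltW N_gt0).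
  rewrite enorm_sqr; apply: ler_sum => i _.
  by rewrite !mxE natrX expr2.
have rem_le (z : 'cV[R]_n) : (forall i, 0 <= z i 0) ->
    enorm ((20 * N) *: z - tc z) <= N.
  move=> z0; rewrite -[leRHS]/(Num.sqrt _) /enorm; apply: ler_wsqrtr.
  rewrite -[leRHS](_ : \sum_(i < n) 1 = _); last by rewrite sumr_const card_ord.
  apply: ler_sum => i _; rewrite !mxE.
  have /andP[h1 h2] := truncn_itv (zi _ _ (z0 i)).
  rewrite -/(trunc z i) in h1 h2; rewrite -[ltRHS]natr1 in h2.
  by rewrite -[leRHS](expr1n _ 2) ler_pXn2r ?nnegrE//; lra.
set a := (20 * N) *: x; set b := (20 * N) *: y.
have ab : inner a (E *m b) = 400 * n%:R * inner x (E *m y).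
  by rewrite innerZl -scalemxAr innerZr -NN; ring.
(* Each of the last two terms pairs a vector of norm at most 20 N with a remainder of norm at most
   N; together they cost 40 n S. *)
have abE : inner a (E *m b) = inner (tc x) (E *m tc y)
    + inner (tc x) (E *m (b - tc y)) + inner (a - tc x) (E *m b).
  by rewrite mulmxBr !innerDr !innerDl !innerNl innerNr; ring.
have h1 : `|inner (tc x) (E *m tc y)| <= T * n%:R * N.
  have := E_net (tc_sum x x0 x1) (tc_sum y y0 y1); congr (`|_| <= _).
  apply: eq_bigr => i _; rewrite !mxE mulr_sumr.
  by apply: eq_bigr => j _; rewrite mxE mulrA.
have h2 : `|inner (tc x) (E *m (b - tc y))| <= S * (20 * N * N).
  apply: le_trans (bS _ _) _; apply: ler_wpM2l => //.
  by apply: ler_pM; rewrite ?enorm_ge0 ?tc_le ?rem_le.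
have h3 : `|inner (a - tc x) (E *m b)| <= S * (N * (20 * N)).
  apply: le_trans (bS _ _) _; apply: ler_wpM2l => //.
  apply: ler_pM; rewrite ?enorm_ge0 ?rem_le//.
  have N20 : 0 < 20 * N by rewrite mulr_gt0.
  by rewrite enormZ gtr0_norm// ler_piMr// ltW.
have : `|inner a (E *m b)| <= T * n%:R * N + 40 * n%:R * S.
  rewrite abE; apply: le_trans (ler_normD _ _) _.
  apply: le_trans (lerD (ler_normD _ _) (lexx _)) _.
  by rewrite -NN in h1 *; lra.
have n0 : 0 < n%:R :> R by rewrite ltr0n.
rewrite ab normrM gtr0_norm ?mulr_gt0// ler_pdivlMr//.
have -> : T * n%:R * N + 40 * n%:R * S = n%:R * (T * N + 40 * S) by ring.
have -> (z : R) : 400 * n%:R * z = n%:R * (z * 400) by ring.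
by rewrite ler_pM2l.
Qed.

(** Splitting x and y into positive and negative parts gives four nonnegative forms, with total at
    most T N / 100 + 2 S / 5. *)
Lemma bounded_by_step S : 0 <= S -> bounded_by S ->
  bounded_by (T * N / 100 + S / 2).
Proof.
move=> S0 bS; apply: bounded_by_unit => x y x1 y1.
pose pos (z : 'cV[R]_n) : 'cV[R]_n := \col_i Num.max (z i 0) 0.
have posE (z : 'cV[R]_n) : z = pos z - pos (- z).
  apply/matrixP => i j; rewrite (ord1 j) !mxE.
  by rewrite /Num.max; do 2 case: ifP; lra.
have pos_ge0 (z : 'cV[R]_n) i : 0 <= pos z i 0 by rewrite mxE le_max lexx orbT.
have pos_le (z : 'cV[R]_n) : enorm z <= 1 -> enorm (pos z) <= 1.
  apply: le_trans; apply: enorm_le => i; rewrite !mxE.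
  by rewrite /Num.max; case: ifP => // _; rewrite normr0.
have b (u v : 'cV[R]_n) : enorm u <= 1 -> enorm v <= 1 ->
    `|inner (pos u) (E *m pos v)| <= (T * N + 40 * S) / 400.
  by move=> u1 v1; apply: bounded_nonneg; rewrite ?pos_le.
have xN : enorm (- x) <= 1 by rewrite enormN.
have yN : enorm (- y) <= 1 by rewrite enormN.
have e1 := b _ _ x1 y1; have e2 := b _ _ xN y1.
have e3 := b _ _ x1 yN; have e4 := b _ _ xN yN.
rewrite {1}(posE x) {1}(posE y) mulmxBr !innerDr !innerDl !innerNl !innerNr.
move: e1 e2 e3 e4; rewrite !ler_norml.
have TN : 0 <= T * N by rewrite mulr_ge0 ?(ltW N_gt0).
move=> /andP[? ?] /andP[? ?] /andP[? ?] /andP[? ?].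
by apply/andP; split; lra.
Qed.

Lemma net_enorm_le (v : 'cV[R]_n) :
  enorm (E *m v) <= (T / 50 + 1) * N * enorm v.
Proof.
have TN : 0 <= T * N by rewrite mulr_ge0 ?(ltW N_gt0).
(* T N / 50 is the fixed point of S -> T N / 100 + S / 2, and the initial excess is halved at each
   step. *)
have iter j : bounded_by (T * N / 50 + n%:R ^+ 2 / 2 ^+ j).
  elim: j => [|j IH].
    move=> x y; apply: le_trans (bounded_by_trivial x y) _.
    rewrite expr0 divr1 ler_wpM2r ?mulr_ge0 ?enorm_ge0// lerDr.
    by rewrite divr_ge0.
  have := bounded_by_step _ IH.
  have -> : T * N / 100 + (T * N / 50 + n%:R ^+ 2 / 2 ^+ j) / 2 =
    T * N / 50 + n%:R ^+ 2 / 2 ^+ j.+1.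
    by rewrite [2 ^+ j.+1]exprS; field; rewrite expf_neq0 ?pnatr_eq0.
  apply; rewrite addr_ge0 ?divr_ge0// ?exprn_ge0//.
have N1 : 1 <= N.
  by rewrite -sqrtr1; apply: ler_wsqrtr; rewrite (ler_nat R 1).
have small : n%:R ^+ 2 / 2 ^+ (n * 2) <= N :> R.
  apply: le_trans N1; rewrite ler_pdivrMr ?exprn_gt0// mul1r exprM.
  rewrite ler_pXn2r ?nnegrE ?exprn_ge0// -natrX ler_nat.
  by rewrite ltnW// ltn_expl.
(* After 2n steps the excess is at most N, since n <= 2^n. Testing against x = E v turns the form
   into |E v|^2. *)
have := iter (n * 2)%N (E *m v) v.
rewrite ger0_norm ?inner_ge0// -enorm_sqr.
have [->|vn] := eqVneq (enorm (E *m v)) 0.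
  by move=> _; rewrite !mulr_ge0 ?enorm_ge0 ?(ltW N_gt0)// addr_ge0 ?divr_ge0.
have vp : 0 < enorm (E *m v) by rewrite lt0r vn enorm_ge0.
rewrite mulrCA expr2 ler_pM2l// => h; apply: le_trans h _.
by rewrite ler_wpM2r ?enorm_ge0//; lra.
Qed.

End Net.

(** * Concentration *)

Section Mgf.
Variable R : realType.

(* For [x <= 1], [expR x = expR (x / 2) ^+ 2 <= (1 - x / 2)^-2]. *)
Lemma expR_le_sub_gaussian (x : R) : expR x <= x + expR (2 * x ^+ 2).
Proof.
have [x1|x1] := leP x 1; last first.
  have : expR x <= expR (2 * x ^+ 2) by rewrite ler_expR; nra.
  by lra.
apply: (@le_trans _ _ (1 + x + 2 * x ^+ 2)); last first.
  by have := expR_ge1Dx (2 * x ^+ 2); lra.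
have h := expR_ge1Dx (- (x / 2)).
have E : expR x * expR (- (x / 2)) ^+ 2 = 1.
  by rewrite -expRM_natl -expRD -[RHS]expR0; congr expR; field.
have e0 := expR_ge0 x.
have h2 : expR x * (1 - x / 2) ^+ 2 <= 1.
  rewrite -[leRHS]E ler_wpM2l// ler_pXn2r ?nnegrE ?expR_ge0//; lra.
have h3 : 1 <= (1 + x + 2 * x ^+ 2) * (1 - x / 2) ^+ 2.
  rewrite -subr_ge0 (_ : _ - _ = x ^+ 2 * ((1 - x) * (5 / 2 - x) / 2)); last by field.
  by apply: mulr_ge0; [exact: sqr_ge0 | apply: divr_ge0 => //; apply: mulr_ge0; lra].
have h4 : 0 < (1 - x / 2) ^+ 2 by apply: exprn_gt0; lra.
by rewrite -(ler_pM2r h4); apply: le_trans h2 h3.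
Qed.

(** The estimate expR x <= x + expR (2 x^2) is averaged over the centred variable, whose linear
    terms cancel. *)
Lemma bernoulli_mgf (q t : R) : 0 <= q -> q <= 1 ->
  q * expR (t * (1 - q)) + (1 - q) * expR (t * (0 - q)) <= expR (2 * t ^+ 2).
Proof.
move=> q0 q1.
have b (z : R) : -1 <= z -> z <= 1 -> expR (t * z) <= t * z + expR (2 * t ^+ 2).
  move=> z0 z1; apply: le_trans (expR_le_sub_gaussian _) _.
  rewrite lerD2l; rewrite ler_expR; rewrite exprMn.
  have z2 : z ^+ 2 <= 1 by nra.
  by have := sqr_ge0 t; nra.
have h1 : q * expR (t * (1 - q)) <= q * (t * (1 - q) + expR (2 * t ^+ 2)).
  by apply: ler_wpM2l => //; apply: b; lra.
have h2 : (1 - q) * expR (t * (0 - q)) <= (1 - q) * (t * (0 - q) + expR (2 * t ^+ 2)).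
  by apply: ler_wpM2l; [lra | apply: b; lra].
apply: le_trans (lerD h1 h2) _.
by rewrite le_eqVlt; apply/orP; left; apply/eqP; ring.
Qed.

End Mgf.

(** * The product measure and exponential moments of the noise *)

Section RandomGraph.
Variables (R : realType) (p : R) (n : nat).
Hypothesis p_ge0 : 0 <= p.
Hypothesis p_le1 : p <= 1.

Lemma model_mx_itv i j : 0 <= model_mx n p i j <= 1.
Proof. by rewrite mxE; case: ifP => _; rewrite ?p_ge0 ?p_le1 ?lexx ?ler01. Qed.

(** The factor of [weight] at one coordinate; off the strict upper triangle it is the point mass at
    [false]. *)
Let pw (ij : 'I_n * 'I_n) (b : bool) : R :=
  if (ij.1 < ij.2)%N then
    (if b then model_mx n p ij.1 ij.2 else 1 - model_mx n p ij.1 ij.2)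
  else (if b then 0 else 1).

Lemma weight_ge0 (w : outcome n) : 0 <= weight p w.
Proof.
apply: prodr_ge0 => ij _; have /andP[h0 h1] := model_mx_itv ij.1 ij.2.
by do 2 case: ifP => _ //; rewrite ?subr_ge0.
Qed.

(** Independence of the coordinates, obtained by distributing the product over the sums. *)
Lemma expect_prod (f : 'I_n * 'I_n -> bool -> R) :
  \sum_(w : outcome n) weight p w * \prod_ij f ij (w ij) =
  \prod_ij (pw ij true * f ij true + pw ij false * f ij false).
Proof.
transitivity (\prod_ij \sum_b pw ij b * f ij b).
  rewrite bigA_distr_bigA; apply: eq_bigr => w _.
  by rewrite -big_split.
by apply: eq_bigr => ij _; rewrite big_bool.
Qed.

Lemma sum_weight : \sum_(w : outcome n) weight p w = 1.
Proof.
transitivity (\sum_(w : outcome n) weight p w * \prod_(ij : 'I_n * 'I_n) 1).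
  by apply: eq_bigr => w _; rewrite big1 ?mulr1.
rewrite (expect_prod (fun _ _ => 1)) big1// => ij _.
by rewrite /pw; case: ifP => _; ring.
Qed.

Lemma prob_ge (G : pred (outcome n)) (E : outcome n -> Prop) :
  (forall w, G w -> E w) -> 1 - \sum_(w | ~~ G w) weight p w <= prob p E.
Proof.
move=> GE; rewrite -sum_weight (bigID G) /= addrK /prob.
rewrite big_mkcond [leRHS]big_mkcond; apply: ler_sum => w _.
have [/GE Ew|_] := boolP (G w); first by rewrite asboolT.
by case: ifP => _; rewrite ?weight_ge0.
Qed.

Definition noise (w : outcome n) : 'M[R]_n := adj_mx R w - model_mx n p.

Lemma noise_le1 w i j : `|noise w i j| <= 1.
Proof.
have /andP[h0 h1] := model_mx_itv i j.
rewrite 2!mxE [X in _ + X]mxE; move: h0 h1; set q := model_mx _ _ _ _ => h0 h1.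
by rewrite ler_norml; do ![case: ifP => _]; apply/andP; split; lra.
Qed.

(** Folding onto i < j leaves one term per independent coordinate. *)
Lemma sum_sym (F : 'I_n -> 'I_n -> R) : (forall i, F i i = 0) ->
  \sum_i \sum_j F i j =
  \sum_(ij : 'I_n * 'I_n) (if (ij.1 < ij.2)%N then F ij.1 ij.2 + F ij.2 ij.1 else 0).
Proof.
move=> F0.
transitivity (\sum_(i < n) \sum_(j < n) (if (i < j)%N then F i j else 0)
            + \sum_(i < n) \sum_(j < n) (if (j < i)%N then F i j else 0)).
  rewrite -big_split; apply: eq_bigr => i _; rewrite -big_split.
  apply: eq_bigr => j _ /=; case: ltngtP => [ij|ij|/val_inj ->].
  - by rewrite addr0.
  - by rewrite add0r.
  - by rewrite F0 addr0.
rewrite -(pair_bigA _ (fun i j : 'I_n => if (i < j)%N then F i j + F j i else 0)) /=.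
rewrite [X in _ + X]exchange_big -big_split; apply: eq_bigr => i _ /=.
by rewrite -big_split; apply: eq_bigr => j _ /=; case: ifP; rewrite ?addr0.
Qed.

Definition form (k l : 'I_n -> nat) (w : outcome n) : R :=
  \sum_i \sum_j (k i)%:R * noise w i j * (l j)%:R.

Let coef (k l : 'I_n -> nat) (ij : 'I_n * 'I_n) : R :=
  if (ij.1 < ij.2)%N then (k ij.1)%:R * (l ij.2)%:R + (k ij.2)%:R * (l ij.1)%:R
  else 0.

Lemma formE k l w : form k l w =
  \sum_ij coef k l ij * ((if w ij then 1 else 0) - model_mx n p ij.1 ij.2).
Proof.
rewrite /form sum_sym; last first.
  by move=> i; rewrite !mxE ltnn eqxx /= subrr mulr0 mul0r.
apply: eq_bigr => -[i j] _ /=; rewrite /coef /=; case: ifP => [ij|_]; last by rewrite mul0r.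
have -> : noise w j i = noise w i j.
  rewrite [LHS]mxE [RHS]mxE; congr (_ + _).
    by rewrite !mxE; case: ltngtP ij.
  by rewrite [LHS]mxE [RHS]mxE -[in LHS]model_mx_sym mxE.
have -> : noise w i j = (if w (i, j) then 1 else 0) - model_mx n p i j.
  by rewrite [LHS]mxE [X in _ + X]mxE [X in X + _]mxE ij.
by rewrite mulrDl; congr (_ + _); rewrite mulrAC.
Qed.

(** Uses (a + b)^2 <= 2 (a^2 + b^2) for the two terms folded onto each edge. *)
Lemma sum_coef_sqr k l : \sum_ij coef k l ij ^+ 2 <=
  2 * ((\sum_i k i ^ 2) * (\sum_i l i ^ 2))%N%:R.
Proof.
pose G (i j : 'I_n) : R := if i == j then 0 else (k i ^ 2)%N%:R * (l j ^ 2)%N%:R.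
apply: (@le_trans _ _ (2 * \sum_i \sum_j G i j)); last first.
  rewrite ler_pM2l// natrM !natr_sum mulr_suml; apply: ler_sum => i _.
  rewrite mulr_sumr; apply: ler_sum => j _.
  by rewrite /G; case: ifP => // _; rewrite mulr_ge0.
rewrite sum_sym; last by move=> i; rewrite /G eqxx.
rewrite mulr_sumr; apply: ler_sum => -[i j] _ /=; rewrite /coef /=.
case: ifP => [ij|_]; last by rewrite expr0n mulr0.
have ne : (i == j) = false by rewrite -val_eqE /= ltn_eqF.
have ne' : (j == i) = false by rewrite eq_sym.
rewrite /G ne ne' !natrX.
set a := (k i)%:R; set b := (l j)%:R; set c := (k j)%:R; set d := (l i)%:R.
have := sqr_ge0 (a * b - c * d); lra.
Qed.

(** The exponential factors over independent coordinates, and [bernoulli_mgf] bounds each factor. *)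
Lemma form_mgf (k l : 'I_n -> nat) (t : R) :
  \sum_(w : outcome n) weight p w * expR (t * form k l w) <=
  expR (2 * t ^+ 2 * \sum_ij coef k l ij ^+ 2).
Proof.
pose f ij (b : bool) : R :=
  expR (t * coef k l ij * ((if b then 1 else 0) - model_mx n p ij.1 ij.2)).
rewrite (eq_bigr (fun w : outcome n => weight p w * \prod_ij f ij (w ij))); last first.
  move=> w _; rewrite formE mulr_sumr expR_sum; congr (_ * _).
  by apply: eq_bigr => ij _; rewrite mulrA.
rewrite expect_prod mulr_sumr expR_sum; apply: ler_prod => ij _.
rewrite /pw /f /coef; case: ifP => _; last first.
  by rewrite !(mulr0, mul0r) expr0n mulr0 expR0 mulr1 add0r ler01 lexx.
have /andP[h0 h1] := model_mx_itv ij.1 ij.2.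
rewrite addr_ge0 ?mulr_ge0 ?expR_ge0 ?subr_ge0//=.
by apply: le_trans (bernoulli_mgf _ h0 h1) _; rewrite exprMn mulrA.
Qed.

(** * Tail estimate and union bound over short integer vectors *)

Hypothesis n_gt0 : (0 < n)%N.

(** The first term matches the exponent of [form_mgf] at t = N^-1; the surplus 1000 pays for the
    union bound. *)
Definition net_const : R := 4 * 400 ^+ 2 + 1000.

Let N : R := Num.sqrt n%:R.

Let N_gt0 : 0 < N. Proof. by rewrite sqrtr_gt0 ltr0n. Qed.
Let NN : N ^+ 2 = n%:R. Proof. by rewrite sqr_sqrtr ?ler0n. Qed.

Definition short (k : 'I_n -> nat) := (\sum_i k i ^ 2 <= 400 * n)%N.

(** With t^2 = 1 / n the moment exponent is at most 2 t^2 * 2 (400 n)^2 = 4 * 400^2 n. The two signs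
    of t serve the two tails. *)
Lemma form_tail k l : short k -> short l ->
  \sum_(w : outcome n) weight p w *
    (expR (N^-1 * form k l w - net_const * n%:R)
     + expR (- N^-1 * form k l w - net_const * n%:R))
  <= 2 * expR (- (1000 * n%:R)).
Proof.
move=> sk sl; have n0 : 0 < n%:R :> R by rewrite ltr0n.
have b (t : R) : t ^+ 2 = n%:R^-1 ->
    \sum_(w : outcome n) weight p w * expR (t * form k l w) <=
    expR (4 * 400 ^+ 2 * n%:R).
  move=> tn; apply: le_trans (form_mgf k l t) _; rewrite ler_expR.
  have h : \sum_ij coef k l ij ^+ 2 <= 2 * (400 * n%:R) ^+ 2.
    apply: le_trans (sum_coef_sqr k l) _; rewrite ler_pM2l//.
    rewrite expr2 -natrM -[leRHS]natrM ler_nat.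
    exact: leq_mul.
  apply: (@le_trans _ _ (2 * t ^+ 2 * (2 * (400 * n%:R) ^+ 2))).
    by rewrite ler_wpM2l// mulr_ge0 ?sqr_ge0.
  rewrite tn le_eqVlt; apply/orP; left; apply/eqP; field.
  by rewrite gt_eqF.
have tn : N^-1 ^+ 2 = n%:R^-1 by rewrite exprVn NN.
have tn' : (- N^-1) ^+ 2 = n%:R^-1 by rewrite sqrrN tn.
have h := lerD (b _ tn) (b _ tn').
rewrite (eq_bigr (fun w : outcome n => expR (- (net_const * n%:R)) *
  (weight p w * expR (N^-1 * form k l w)
   + weight p w * expR (- N^-1 * form k l w)))); last first.
  by move=> w _; rewrite !expRD; ring.
rewrite -mulr_sumr big_split /=.
apply: le_trans (ler_wpM2l (expR_ge0 _) h) _.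
rewrite -mulr2n -[X in _ * X]mulr_natl mulrCA ler_pM2l// -expRD.
by rewrite ler_expR; rewrite /net_const; lra.
Qed.

(** Entries of a short vector satisfy k_i <= k_i^2 <= 400 n, so short vectors live in a finite
    type. *)
Let K := (400 * n).+1.
Let nv (k : {ffun 'I_n -> 'I_K}) (i : 'I_n) : nat := k i.

Lemma geometric_half k : \sum_(j < k) (2^-1 : R) ^+ j <= 2.
Proof.
have -> : \sum_(j < k) (2^-1 : R) ^+ j = 2 - 2 * 2^-1 ^+ k.
  elim: k => [|k IH]; first by rewrite big_ord0 expr0; ring.
  by rewrite big_ord_recr /= IH exprS; field.
by rewrite lerBlDr lerDl mulr_ge0// exprn_ge0// invr_ge0.
Qed.

Lemma leq_sqr a : (a <= a ^ 2)%N.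
Proof. by case: a => // a; rewrite -mulnn leq_pmulr. Qed.

(* Each short [k] satisfies [1 <= 2 ^ (400 n) * prod_i 2 ^ (- k_i)]. *)
Lemma card_short :
  \sum_(k : {ffun 'I_n -> 'I_K} | short (nv k)) (1 : R) <= 2 ^+ (400 * n + n).
Proof.
apply: (@le_trans _ _ (\sum_(k : {ffun 'I_n -> 'I_K})
    2 ^+ (400 * n) * \prod_i (2^-1 : R) ^+ k i)).
  rewrite big_mkcond; apply: ler_sum => k _; rewrite prodrXr.
  case: ifP => [sk|_]; last by rewrite mulr_ge0 ?exprn_ge0 ?invr_ge0.
  rewrite exprVn ler_pdivlMr ?exprn_gt0// mul1r ler_weXn2l ?ler1n//.
  by apply: leq_trans sk; apply: leq_sum => i _; exact: leq_sqr.
rewrite -mulr_sumr exprD ler_pM2l ?exprn_gt0//.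
rewrite -(bigA_distr_bigA (fun (_ : 'I_n) (j : 'I_K) => (2^-1 : R) ^+ j)).
rewrite prodr_const card_ord; apply: lerXn2r; rewrite ?nnegrE ?geometric_half//.
by apply: sumr_ge0 => j _; rewrite exprn_ge0 ?invr_ge0.
Qed.

Definition tame (w : outcome n) : bool :=
  [forall k : {ffun 'I_n -> 'I_K}, forall l : {ffun 'I_n -> 'I_K},
    short (nv k) ==> short (nv l) ==> (`|form (nv k) (nv l) w| <= net_const * n%:R * N)].

(** Chernoff's inequality in pointwise form: for a violating pair one of the two exponents is
    nonnegative. *)
Lemma not_tame_le w : ~~ tame w ->
  1 <= \sum_(k : {ffun 'I_n -> 'I_K} | short (nv k))
    \sum_(l : {ffun 'I_n -> 'I_K} | short (nv l))
    (expR (N^-1 * form (nv k) (nv l) w - net_const * n%:R)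
     + expR (- N^-1 * form (nv k) (nv l) w - net_const * n%:R)).
Proof.
rewrite negb_forall => /existsP[k]; rewrite negb_forall => /existsP[l].
rewrite !negb_imply -ltNge => /and3P[sk sl].
have e0 (x y : R) : 0 <= expR x + expR y by rewrite addr_ge0 ?expR_ge0.
move=> big; rewrite (bigD1 k)//= (bigD1 l)//= -addrA.
set t := N^-1 * form (nv k) (nv l) w - _; set t' := - N^-1 * form (nv k) (nv l) w - _.
apply: (@le_trans _ _ (expR t + expR t')); last first.
  rewrite lerDl addr_ge0//; first by apply: sumr_ge0 => j _.
  by apply: sumr_ge0 => j _; apply: sumr_ge0 => j' _.
have : 0 <= t \/ 0 <= t'.
  have nE : net_const * n%:R = N^-1 * (net_const * n%:R * N).
    by field; rewrite gt_eqF.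
  rewrite /t /t' nE mulNr -mulrN -!mulrBr !pmulr_rge0 ?invr_gt0// !subr_ge0.
  by move: big; rewrite ltr_normr => /orP[] /ltW; [left | right].
have e1 (x : R) : 0 <= x -> 1 <= expR x.
  by move=> x0; rewrite -expR0; rewrite ler_expR.
by case=> /e1 h; [have := expR_ge0 t' | have := expR_ge0 t]; lra.
Qed.

Lemma prob_not_tame : \sum_(w | ~~ tame w) weight p w <= (n%:R ^+ 3)^-1.
Proof.
pose X k l w := expR (N^-1 * form (nv k) (nv l) w - net_const * n%:R)
     + expR (- N^-1 * form (nv k) (nv l) w - net_const * n%:R).
apply: (@le_trans _ _ (\sum_(w : outcome n) weight p w *
    \sum_(k : {ffun 'I_n -> 'I_K} | short (nv k))
    \sum_(l : {ffun 'I_n -> 'I_K} | short (nv l)) X k l w)).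
  rewrite big_mkcond; apply: ler_sum => w _; case: ifP => [nt|_].
    by rewrite ler_peMr ?weight_ge0// not_tame_le.
  rewrite mulr_ge0 ?weight_ge0//.
  by do 2 apply: sumr_ge0 => ? _; rewrite addr_ge0 ?expR_ge0.
have -> : \sum_(w : outcome n) weight p w *
    \sum_(k : {ffun 'I_n -> 'I_K} | short (nv k))
    \sum_(l : {ffun 'I_n -> 'I_K} | short (nv l)) X k l w =
    \sum_(k : {ffun 'I_n -> 'I_K} | short (nv k))
    \sum_(l : {ffun 'I_n -> 'I_K} | short (nv l))
    \sum_(w : outcome n) weight p w * X k l w.
  under eq_bigr do rewrite mulr_sumr.
  rewrite exchange_big; apply: eq_bigr => k _ /=.
  under eq_bigr do rewrite mulr_sumr.
  by rewrite exchange_big.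
set B := 2 * expR (- (1000 * n%:R)) : R.
apply: (@le_trans _ _ (\sum_(k : {ffun 'I_n -> 'I_K} | short (nv k))
    \sum_(l : {ffun 'I_n -> 'I_K} | short (nv l)) B)).
  by do 2 apply: ler_sum => ? ?; apply: form_tail.
have -> : \sum_(k : {ffun 'I_n -> 'I_K} | short (nv k))
    \sum_(l : {ffun 'I_n -> 'I_K} | short (nv l)) B =
   B * ((\sum_(k : {ffun 'I_n -> 'I_K} | short (nv k)) (1 : R))
        * (\sum_(k : {ffun 'I_n -> 'I_K} | short (nv k)) (1 : R))).
  rewrite mulr_suml mulr_sumr; apply: eq_bigr => k _.
  by rewrite mul1r mulr_sumr; apply: eq_bigr => l _; rewrite mulr1.
have c0 : 0 <= \sum_(k : {ffun 'I_n -> 'I_K} | short (nv k)) (1 : R) by exact: sumr_ge0.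
have e2 : 2 <= expR 1 :> R by have := expR_ge1Dx (1 : R); lra.
have cc : \sum_(k : {ffun 'I_n -> 'I_K} | short (nv k)) (1 : R) <= expR (401 * n%:R).
  apply: le_trans card_short _.
  have -> : 401 * n%:R = (400 * n + n)%N%:R :> R by rewrite natrD natrM; ring.
  rewrite -[X in expR X]mulr1 expRM_natl.
  by apply: lerXn2r; rewrite ?nnegrE ?expR_ge0.
have n0 : 0 < n%:R :> R by rewrite ltr0n.
have n1 : 1 <= n%:R :> R by rewrite (ler_nat R 1).
apply: (@le_trans _ _ (B * (expR (401 * n%:R) * expR (401 * n%:R)))).
  by rewrite ler_wpM2l ?mulr_ge0 ?expR_ge0//; apply: ler_pM.
rewrite /B -expRD -mulrA -expRD.
(* The exponent is 802 n - 1000 n = -198 n. With 2 <= e^n and -198 n <= -4 n, the bound e^(-3n) <=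
   n^-3 remains. *)
apply: (@le_trans _ _ (expR n%:R * expR (- (4 * n%:R)))).
  apply: ler_pM; rewrite ?expR_ge0//.
    by apply: le_trans e2 _; rewrite ler_expR.
  by rewrite ler_expR; lra.
rewrite -expRD (_ : _ + _ = - (3%:R * n%:R)); last by ring.
rewrite expRN expRM_natl lef_pV2 ?posrE ?exprn_gt0 ?expR_gt0//.
apply: lerXn2r; rewrite ?nnegrE ?expR_ge0//.
by have := expR_ge1Dx (n%:R : R); lra.
Qed.

Lemma tame_noise_le w v : tame w ->
  enorm (noise w *m v) <= (net_const / 50 + 1) * N * enorm v.
Proof.
move=> /forallP tw; apply: net_enorm_le => //.
- by rewrite addr_ge0 ?mulr_ge0 ?exprn_ge0.
- exact: noise_le1.
move=> k l sk sl.
have inK (f : 'I_n -> nat) : short f -> exists f', f = nv f'.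
  move=> sf; exists [ffun i => inord (f i)]; apply/funext => i.
  rewrite /nv ffunE inordK// ltnS; apply: leq_trans sf.
  by rewrite (bigD1 i)//=; apply: leq_trans (leq_addr _ _); exact: leq_sqr.
have [k' kE] := inK k sk; have [l' lE] := inK l sl.
have /forallP/(_ l')/implyP := tw k'.
by rewrite -kE -lE => /(_ sk)/implyP/(_ sl).
Qed.

End RandomGraph.

(** * Combination of the gaps, the noise bound and the perturbation estimate *)

Lemma adj_mx_sym (R : realType) n (w : outcome n) : (adj_mx R w)^T = adj_mx R w.
Proof. by apply/matrixP => i j; rewrite !mxE; case: ltngtP. Qed.

Lemma enorm_sub_le2 (R : realType) n (x y : 'cV[R]_n) :
  enorm x = 1 -> enorm y = 1 -> enorm (x - y) <= 2.
Proof.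
move=> x1 y1; apply: le_trans (enormD_le _ _) _.
by rewrite enormN x1 y1.
Qed.

Theorem theorem1 (R : realType) (p : R) (hp0 : 0 < p) (hp1 : p < 1) :
  exists C0 : R, 0 < C0 /\
  forall n : nat, (0 < n)%N -> ~~ odd n ->
    1 - (n%:R ^+ 3)^-1 <=
    prob p (fun w : outcome n =>
      forall (l lh : R) (x xh : 'cV[R]_n),
        is_lambda2 (model_mx n p) l -> unit_eigvec (model_mx n p) l x ->
        is_lambda2 (adj_mx R w) lh -> unit_eigvec (adj_mx R w) lh xh ->
        0 <= inner x xh ->
        enorm (x - xh) <= C0 * (Num.sqrt n%:R)^-1).
Proof.
pose Ce : R := net_const R / 50 + 1.
have Ce0 : 0 < Ce.
  by rewrite ltr_wpDl// divr_ge0// addr_ge0 ?mulr_ge0 ?exprn_ge0.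
have CeE : Ce = net_const R / 50 + 1 by [].
clearbody Ce.
(* If 2 N <= C0 the trivial bound |x - xh| <= 2 suffices. Otherwise N > 200 Ce / p + 2000, which
   forces m >= 1000 and makes the gap dominate the noise. *)
exists (400 * Ce / p + 4000); split.
  by rewrite addr_gt0// divr_gt0// mulr_gt0.
move=> n n0 n_even.
have p0 := ltW hp0; have p1 := ltW hp1.
have [m nE] : exists m, n = (m + m)%N.
  by exists n./2; rewrite addnn even_halfK.
have lb : 1 - (n%:R ^+ 3)^-1 <= 1 - \sum_(w : outcome n | ~~ tame p w) weight p w.
  by rewrite lerB// prob_not_tame.
apply: (le_trans lb); apply: prob_ge => //.
move=> w tw l lh x xh [s [cs [ss ->]]] ex [t [ct [st ->]]] exh x_xh.
have nR : 0 < n%:R :> R by rewrite ltr0n.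
set N := Num.sqrt n%:R : R.
have N0 : 0 < N by rewrite sqrtr_gt0.
have NN : N ^+ 2 = n%:R by rewrite sqr_sqrtr// ltW.
have le2 : enorm (x - xh) <= 2 by apply: enorm_sub_le2; [case: ex | case: exh].
rewrite ler_pdivlMr//.
have pC : 0 < Ce / p by rewrite divr_gt0.
have [Nsmall|Nbig] := leP (2 * N) (400 * Ce / p + 4000).
  by apply: le_trans Nsmall; rewrite ler_pM2r.
have m1000 : (1000 <= m)%N.
  rewrite leqNgt; apply/negP => m_lt.
  have : N <= 100.
    rewrite -(@ler_pXn2r _ 2) ?nnegrE ?(ltW N0)// NN nE natrD.
    have : m%:R <= 1000 :> R by rewrite (ler_nat R _ 1000) ltnW.
    by lra.
  by lra.
clear lb; case: n nE n0 n_even w tw x xh cs ex ct exh x_xh nR @N N0 NN le2 Nbig => [|[|k]] //.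
move=> nE n0 _ w tw x xh cs ex ct exh x_xh nR N N0 NN le2 Nbig.
have [gap1 gap2] := model_eigenvalue_gaps nE hp0 m1000 cs ss.
have mR : m%:R = N ^+ 2 / 2 by rewrite NN nE natrD; field.
have := @second_eigvec_perturbation R k (model_mx k.+2 p) (adj_mx R w) s t
  (Ce * N) (m%:R * p / 50) x xh (model_mx_sym _ _) (adj_mx_sym _ _) cs ct ss st.
have m0 : 0 < m%:R :> R by rewrite mR divr_gt0 ?exprn_gt0.
have CpN : 200 * (Ce / p) <= N.
  by lra.
(* Equivalent to 2 e <= g for e = Ce N and g = m p / 50 = N^2 p / 100. *)
have CN : 200 * Ce <= N * p by rewrite -ler_pdivrMr// -mulrA.
move=> /(_ _ _ _ gap1 gap2 ex exh x_xh) h.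
have {}h : inner (x - xh) (x - xh) * (m%:R * p / 50) ^+ 2 <= 8 * (Ce * N) ^+ 2.
  apply: h.
  - by move=> v; rewrite CeE; apply: tame_noise_le.
  - by rewrite divr_gt0// mulr_gt0.
  - rewrite mR; nra.
rewrite -enorm_sqr mR in h.
have dn0 := enorm_ge0 (x - xh).
set d := enorm _ in h dn0 *.
(* The perturbation bound reads (d N p)^2 <= 8 * 100^2 Ce^2, and 80000 <= 300^2. *)
have : (d * N * p) ^+ 2 <= (300 * Ce) ^+ 2.
  have N2 : 0 < N ^+ 2 by exact: exprn_gt0.
  rewrite -(ler_pM2r N2).
  have -> : (d * N * p) ^+ 2 * N ^+ 2 =
      100 ^+ 2 * (d ^+ 2 * (N ^+ 2 / 2 * p / 50) ^+ 2) by field.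
  have : 0 <= (Ce * N) ^+ 2 by exact: sqr_ge0.
  have -> : (300 * Ce) ^+ 2 * N ^+ 2 = 100 ^+ 2 * (9 * (Ce * N) ^+ 2) by ring.
  by rewrite ler_pM2l ?exprn_gt0//; lra.
rewrite ler_pXn2r ?nnegrE ?mulr_ge0 ?(ltW N0) ?(ltW Ce0)// => h'.
apply: (@le_trans _ _ (300 * Ce / p)); first by rewrite ler_pdivlMr.
by rewrite -!mulrA; lra.
Qed.
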